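(* For infinitely many positive integers $l$ there exists an $l$-ARS-graph.
   Context: All graphs are finite and simple. A non-edge of a graph is a pair of distinct non-adjacent vertices. $\mathcal{C}$ denotes the family of complete graphs. For a graph $J$, $\iota(J)$ is the family of graphs isomorphic to induced subgraphs of $J$. For families $\mathcal{F}_1,\mathcal{F}_2$, $\mathcal{F}_1\vee\mathcal{F}_2$ is the family of disjoint unions of a graph in $\mathcal{F}_1$ and a graph in $\mathcal{F}_2$, and $\mathcal{F}_1\wedge\mathcal{F}_2$ is the family of joins of a graph in $\mathcal{F}_1$ with a graph in $\mathcal{F}_2$. $K_1$ is the one-vertex graph, $S_3$ the edgeless graph on $3$ vertices, $C_4$ the $4$-cycle, $\bar P_3$ the complement of the $3$-vertex path. For a positive integer $l$, a graph $H$ is an $l$-ARS-graph if: (ARS1) for every $1\le s\le l$, $V(H)$ can be partitioned into $s$ stable sets and $l-s$ cliques; (ARS2) for each $\mathcal{G}\in\{\iota(K_1)\vee\mathcal{C},\ \iota(S_3)\wedge\mathcal{C},\ \iota(C_4)\wedge\mathcal{C},\ \iota(\bar P_3)\wedge\mathcal{C}\}$, $V(H)$ can be partitioned into $l-1$ cliques and a set inducing a graph in $\mathcal{G}$; (ARS3) there is a partition $\mathcal{X}_0=\{X_1,\dots,X_l\}$ of $V(H)$ such that $X_1,\dots,X_{l-2}$ are cliques, each of $H[X_{l-1}]$ and $H[X_l]$ has exactly one non-edge, and the four vertices of these two non-edges form an independent set in $H$; (ARS4) for every partition $\mathcal{X}\neq\mathcal{X}_0$ of $V(H)$ with $|\mathcal{X}|=l$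 there exists $X\in\mathcal{X}$ such that $H[X]$ has at least two non-edges. *)

(* Defs.v *)
From mathcomp Require Import all_boot.
Set Implicit Arguments. Unset Strict Implicit. Unset Printing Implicit Defensive.

Definition simple_graph (T : finType) (e : rel T) : Prop :=
  irreflexive e /\ symmetric e.

Section Graphs.
Variables (T : finType) (e : rel T).

Definition stable (X : {set T}) : bool :=
  [forall u in X, forall v in X, ~~ e u v].
Definition clique (X : {set T}) : bool :=
  [forall u in X, forall v in X, (u != v) ==> e u v].

Definition nonedges (X : {set T}) : {set {set T}} :=
  [set E : {set T} | [&& #|E| == 2, E \subset X &
     [forall u in E, forall v in E, (u != v) ==> ~~ e u v]]].

Definition induces_iota (V : finType) (eJ : rel V) (A : {set T}) : Prop :=
  exists f : T -> V, {in A &, injective f} /\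
    {in A &, forall u v, e u v = eJ (f u) (f v)}.

Definition in_iota_or_C (V : finType) (eJ : rel V) (S : {set T}) : Prop :=
  exists A B : {set T}, [/\ A :&: B = set0, A :|: B = S,
    induces_iota eJ A, clique B &
    {in A & B, forall u v, ~~ e u v}].

Definition in_iota_and_C (V : finType) (eJ : rel V) (S : {set T}) : Prop :=
  exists A B : {set T}, [/\ A :&: B = set0, A :|: B = S,
    induces_iota eJ A, clique B &
    {in A & B, forall u v, e u v}].

Definition cliques_plus (l : nat) (P : {set T} -> Prop) : Prop :=
  exists (S : {set T}) (f : T -> 'I_l.-1), P S /\
    forall u v, u \notin S -> v \notin S -> u != v -> f u = f v -> e u v.

End Graphs.

Definition K1_rel : rel 'I_1 := fun _ _ => false.
Definition S3_rel : rel 'I_3 := fun _ _ => false.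
Definition C4_rel : rel 'I_4 :=
  fun i j => ((i + 1) %% 4 == j) || ((j + 1) %% 4 == i).
(* complement of the path 0 - 1 - 2: the only edge is {0,2} *)
Definition coP3_rel : rel 'I_3 :=
  fun i j => ((i == 0 :> nat) && (j == 2 :> nat)) ||
             ((i == 2 :> nat) && (j == 0 :> nat)).

Section ARS.
Variables (T : finType) (e : rel T) (l : nat).

Definition ARS1 : Prop :=
  forall s, 1 <= s <= l ->
    exists f : T -> 'I_l, forall u v, u != v -> f u = f v ->
      if f u < s then ~~ e u v else e u v.

Definition ARS2 : Prop :=
  [/\ cliques_plus e l (in_iota_or_C e K1_rel),
      cliques_plus e l (in_iota_and_C e S3_rel),
      cliques_plus e l (in_iota_and_C e C4_rel) &
      cliques_plus e l (in_iota_and_C e coP3_rel)].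

Definition ARS34 : Prop :=
  exists X0 : {set {set T}},
    [/\ partition X0 [set: T], #|X0| = l,
      (exists A B : {set T}, [/\ A \in X0, B \in X0 & A != B] /\
          [/\ #|nonedges e A| = 1, #|nonedges e B| = 1,
          (forall X, X \in X0 -> X != A -> X != B -> clique e X) &
          stable e (\bigcup_(E in nonedges e A :|: nonedges e B) E)]) &
      (forall X : {set {set T}}, partition X [set: T] -> #|X| = l ->
          X != X0 -> exists2 Y, Y \in X & 2 <= #|nonedges e Y|)].

Definition ARS_graph : Prop := [/\ 0 < l, ARS1, ARS2 & ARS34].
End ARS.

(* Main.v *)
Require Import Defs.
From mathcomp Require Import all_boot.
From mathcomp Require Import zify.
Set Implicit Arguments. Unset Strict Implicit. Unset Printing Implicit Defensive.

(** We work in the complement graph [g], where cliques become stable sets and joins of graphs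
    correspond to disjoint unions of the original graphs.  Call [g] rigid (with [l] colours) when a
    fixed surjective [c], all of whose classes have at least three vertices, is up to renaming the
    only [l]-colouring with at most one monochromatic edge per class.  Rigidity is preserved by
    joins: a colour class meeting both sides of the join is a single pair, and if [q] such pairs
    occurred, then on one of the two sides the [q] vertices involved could be regrouped two by two
    within the allowed number of colours, producing an admissible colouring with a class of size at
    most two.

    An explicit 13-vertex graph satisfies (ARS2)-(ARS4) with [l = 3].  To obtain (ARS1), join it
    with [k >= 13] copies of a rigid, properly 3-colourable 12-vertex gadget that is the union of one clique
    and two stable sets.  Each copy adds 3 to [l] but costs only 2 stable sets as soon as one clique
    is available, so for [s <= k] the condition (ARS1) follows from a cover by one clique and [3 + 2k]
    stable sets; for [s >= 13] it follows from a cover by 13 cliques, each taking at most one vertex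
    from every factor of the join. *)

(** * Rigid colourings and the merging of singleton classes *)

Section Rigid.
Variables (T : finType) (g : rel T).

(** Monochromatic edges are non-edges inside a part of the complement, so this negates the
    conclusion of (ARS4). Edges are compared as sets because each occurs in both orientations. *)
Definition almost_proper (f : T -> nat) : Prop :=
  forall u v u' v', g u v -> g u' v' -> f u = f v -> f u' = f v' ->
    f u = f u' -> [set u; v] = [set u'; v'].

Record rigid (l : nat) (c : T -> nat) : Prop := Rigid {
  rigid_irr : irreflexive g;
  rigid_sym : symmetric g;
  rigid_lt : forall u, c u < l;
  rigid_onto : forall i, i < l -> exists u, c u = i;
  rigid_big : forall u, 2 < #|[set v | c v == c u]|;
  rigid_unique : forall f, (forall u, f u < l) -> almost_proper f ->
    forall u v, (f u == f v) = (c u == c v) }.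

Variables (l : nat) (c : T -> nat).
Hypothesis gc : rigid l c.

(** Colours in [P] are kept; those in [M], each used at most once, are merged two by two. A merged
    class has at most two vertices, hence at most one edge, so the result is admissible; but
    uniqueness forces classes of at least three vertices. *)
Lemma rigid_pairing (f : T -> nat) (P M : seq nat) :
    almost_proper f -> (forall u, f u \in P ++ M) ->
    {in M, forall i, i \notin P} ->
    (forall u v, f u \in M -> f u = f v -> u = v) ->
    size P + uphalf (size M) <= l ->
  forall u, f u \notin M.
Proof.
move=> fA fPM MP fM le_l.
pose f' u := if f u \in P then index (f u) P
             else size P + (index (f u) M)./2.
have f'P u : (f' u < size P) = (f u \in P).
  by rewrite /f'; case: ifP => [|_]; [rewrite index_mem | lia].
have fM' u : f u \notin P -> f u \in M by have:= fPM u; rewrite mem_cat => /orP[->|].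
(* Positions in [M] with equal halves differ at most in parity, so two of any three coincide. *)
have inj3 x y z : f x \notin P -> f' y = f' x -> f' z = f' x ->
    [|| x == y, y == z | z == x].
  move=> xP yx zx.
  have yP : f y \notin P by rewrite -f'P yx f'P.
  have zP : f z \notin P by rewrite -f'P zx f'P.
  move: yx zx; rewrite /f' (negPf xP) (negPf yP) (negPf zP) => yx zx.
  have [xM yM zM] := And3 (fM' _ xP) (fM' _ yP) (fM' _ zP).
  have eqM u v : f u \in M -> f v \in M -> index (f u) M = index (f v) M -> u = v.
    by move=> uM vM e; apply: (fM _ _ uM); exact: (index_inj 0 uM vM e).
  have [] : [\/ index (f x) M = index (f y) M, index (f y) M = index (f z) M |
             index (f z) M = index (f x) M].
  - have e1 := odd_double_half (index (f x) M).
    have e2 := odd_double_half (index (f y) M).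
    have e3 := odd_double_half (index (f z) M).
    have yx' : (index (f y) M)./2 = (index (f x) M)./2 by lia.
    have zx' : (index (f z) M)./2 = (index (f x) M)./2 by lia.
    rewrite yx' in e2; rewrite zx' in e3.
    case: (odd (index (f x) M)) (odd (index (f y) M)) (odd (index (f z) M)) e1 e2 e3
      => [] [] [] e1 e2 e3; by [constructor 1; lia | constructor 2; lia | constructor 3; lia].
  - by move/(eqM _ _ xM yM) ->; rewrite eqxx.
  - by move/(eqM _ _ yM zM) ->; rewrite eqxx orbT.
  - by move/(eqM _ _ zM xM) ->; rewrite eqxx !orbT.
have f'l u : f' u < l.
  have [uP|uP] := boolP (f u \in P).
    by apply: leq_trans (leq_trans (leq_addr _ _) le_l); rewrite f'P.
  apply: leq_trans le_l; rewrite /f' (negPf uP) ltn_add2l gtn_uphalf_double.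
  apply: leq_ltn_trans (_ : index (f u) M < size M); first by rewrite -geq_half_double.
  by rewrite index_mem fM'.
have f'A : almost_proper f'.
  move=> u v u' v' uv uv' fuv fuv' fuu'.
  have nuv : u != v by apply: contraTN uv => /eqP ->; rewrite (rigid_irr gc).
  have nuv' : u' != v' by apply: contraTN uv' => /eqP ->; rewrite (rigid_irr gc).
  have [uP|uP] := boolP (f u \in P).
    have E w : f' w = f' u -> f w = f u.
      move=> ww; have wP : f w \in P by rewrite -f'P ww f'P.
      by move: ww; rewrite /f' wP uP; exact: (index_inj 0).
    have Ev := E v; have Eu' := E u'; have Ev' := E v'.
    by apply: fA => //; rewrite ?Ev ?Eu' ?Ev' //; congruence.
  have u'_uv := inj3 u v u' uP (esym fuv) (esym fuu').
  have v'_uv := inj3 u v v' uP (esym fuv) (etrans (esym fuv') (esym fuu')).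
  apply/setP=> w; rewrite !inE.
  move: u'_uv v'_uv; rewrite (negPf nuv) /=.
  case/orP=> /eqP e1 /orP[] /eqP e2; subst; rewrite ?eqxx // in nuv' *.
  by rewrite orbC.
move=> u; apply/negP=> uM.
have uP := MP _ uM.
case/card_gt2P: (rigid_big gc u) => x [y [z [[]]]].
rewrite !inE -!(rigid_unique gc f'l f'A) => /eqP xu /eqP yu /eqP zu [xy yz zx].
have xP : f x \notin P by rewrite -f'P xu f'P.
have := inj3 x y z xP (etrans yu (esym xu)) (etrans zu (esym xu)).
by rewrite (negPf xy) (negPf yz) (negPf zx).
Qed.

(** With fewer than [l] colours, one vertex could receive a private colour, and [rigid_pairing]
    rules out such a singleton class. *)
Lemma rigid_colours (f : T -> nat) (P : seq nat) :
  0 < l -> almost_proper f -> (forall u, f u \in P) -> l <= size P.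
Proof.
move=> l0 fA fP; rewrite leqNgt; apply/negP=> Pl.
have [u0 _] := rigid_onto gc l0.
(* The shift by one frees colour 0 for [u0]. *)
pose f1 u := if u == u0 then 0 else (f u).+1.
have f1A : almost_proper f1.
  have ne u v : g u v -> f1 u = f1 v -> u != u0 /\ f u = f v.
    rewrite /f1; case: (u =P u0) => [->|]; case: (v =P u0) => [->|] //.
      by rewrite (rigid_irr gc).
    by move=> _ _ _ [].
  move=> u v u' v' uv uv' /(ne _ _ uv)[nu fuv] /(ne _ _ uv')[nu' fuv'].
  by rewrite /f1 (negPf nu) (negPf nu') => -[fuu']; apply: fA.
have: f1 u0 \notin [:: 0]; last by rewrite /f1 eqxx.
apply: (rigid_pairing (P := map succn P) f1A).
- move=> u; rewrite mem_cat /f1; case: eqP => _; first by rewrite orbC.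
  by rewrite mem_map ?fP //; exact: succn_inj.
- by move=> i; rewrite inE => /eqP ->; apply/mapP => -[].
- move=> u v; rewrite inE /f1; case: (u =P u0) => // -> _; by case: eqP.
- by rewrite size_map /=; lia.
Qed.

End Rigid.

(** * Joins and the rigidity of joins *)

Section Glue.
Variables (n m : nat).

Definition glue (X : Type) (a : 'I_n -> X) (b : 'I_m -> X) (i : 'I_(n + m)) : X :=
  match split i with inl u => a u | inr v => b v end.

Lemma glueL X (a : 'I_n -> X) b u : glue a b (lshift m u) = a u.
Proof. by rewrite /glue -[lshift m u]/(unsplit (inl u)) unsplitK. Qed.

Lemma glueR X (a : 'I_n -> X) b v : glue a b (rshift n v) = b v.
Proof. by rewrite /glue -[rshift n v]/(unsplit (inr v)) unsplitK. Qed.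

Lemma ord_sumW (P : 'I_(n + m) -> Prop) :
  (forall u, P (lshift m u)) -> (forall v, P (rshift n v)) -> forall i, P i.
Proof. by move=> PL PR i; rewrite -(splitK i); case: (split i). Qed.

Definition join (g : rel 'I_n) (h : rel 'I_m) : rel 'I_(n + m) :=
  fun i j => match split i, split j with
  | inl u, inl u' => g u u'
  | inr v, inr v' => h v v'
  | _, _ => true
  end.

Variables (g : rel 'I_n) (h : rel 'I_m).

Lemma joinLL u u' : join g h (lshift m u) (lshift m u') = g u u'.
Proof. by rewrite /join -![lshift m _]/(unsplit (inl _)) !unsplitK. Qed.

Lemma joinRR v v' : join g h (rshift n v) (rshift n v') = h v v'.
Proof. by rewrite /join -![rshift n _]/(unsplit (inr _)) !unsplitK. Qed.

Lemma joinLR u v : join g h (lshift m u) (rshift n v).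
Proof.
by rewrite /join -[lshift m u]/(unsplit (inl u)) -[rshift n v]/(unsplit (inr v)) !unsplitK.
Qed.

Lemma joinRL u v : join g h (rshift n v) (lshift m u).
Proof.
by rewrite /join -[lshift m u]/(unsplit (inl u)) -[rshift n v]/(unsplit (inr v)) !unsplitK.
Qed.

Definition joinE := (joinLL, joinRR, joinLR, joinRL).

Lemma almost_properL f : almost_proper (join g h) f -> almost_proper g (f \o lshift m).
Proof.
move=> fA u v u' v' uv uv' e1 e2 e3.
have := fA (lshift m u) (lshift m v) (lshift m u') (lshift m v').
rewrite !joinE => /(_ uv uv' e1 e2 e3) E; apply/setP=> w.
by have /setP/(_ (lshift m w)) := E; rewrite !inE !eq_lshift.
Qed.

Lemma almost_properR f : almost_proper (join g h) f -> almost_proper h (f \o @rshift n m).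
Proof.
move=> fA u v u' v' uv uv' e1 e2 e3.
have := fA (rshift n u) (rshift n v) (rshift n u') (rshift n v').
rewrite !joinE => /(_ uv uv' e1 e2 e3) E; apply/setP=> w.
by have /setP/(_ (rshift n w)) := E; rewrite !inE !eq_rshift.
Qed.

(** The vertex [v] is adjacent to both [u] and [u']; the two edges are monochromatic in one colour,
    hence equal. *)
Lemma almost_proper_mixedL f u u' v : almost_proper (join g h) f ->
  f (lshift m u) = f (rshift n v) -> f (lshift m u) = f (lshift m u') -> u = u'.
Proof.
move=> fA e1 e2.
have := fA _ _ _ _ (joinLR u v) (joinLR u' v) e1 (etrans (esym e2) e1) e2.
by move/setP/(_ (lshift m u)); rewrite !inE eqxx eq_lshift eq_lrshift !orbF => /esym/eqP.
Qed.

Lemma almost_proper_mixedR f u v v' : almost_proper (join g h) f ->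
  f (rshift n v) = f (lshift m u) -> f (rshift n v) = f (rshift n v') -> v = v'.
Proof.
move=> fA e1 e2.
have := fA _ _ _ _ (joinRL u v) (joinRL u v') e1 (etrans (esym e2) e1) e2.
by move/setP/(_ (rshift n v)); rewrite !inE eqxx eq_rshift eq_rlshift !orbF => /esym/eqP.
Qed.

Lemma rigid_join l k c d : 0 < l -> 0 < k -> rigid g l c -> rigid h k d ->
  rigid (join g h) (l + k) (glue c (fun v => l + d v)).
Proof.
move=> l0 k0 gc hd; split.
- by apply: ord_sumW => u; rewrite joinE; [exact: rigid_irr gc u|exact: rigid_irr hd u].
- apply: ord_sumW => u; apply: ord_sumW => v; rewrite !joinE //.
    exact: rigid_sym gc u v.
  exact: rigid_sym hd u v.
- apply: ord_sumW => u; rewrite ?glueL ?glueR; first by have := rigid_lt gc u; lia.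
  by have := rigid_lt hd u; lia.
- move=> i il; have [i_l|l_i] := ltnP i l.
    by have [u cu] := rigid_onto gc i_l; exists (lshift m u); rewrite glueL.
  have [|v dv] := @rigid_onto _ _ _ _ hd (i - l); first by lia.
  by exists (rshift n v); rewrite glueR dv subnKC.
- apply: ord_sumW => u.
    apply: leq_trans (rigid_big gc u) _.
    rewrite -(card_imset _ (@lshift_inj n m)); apply/subset_leq_card/subsetP.
    by move=> _ /imsetP[v + ->]; rewrite !inE !glueL.
  apply: leq_trans (rigid_big hd u) _.
  rewrite -(card_imset _ (@rshift_inj n m)); apply/subset_leq_card/subsetP.
  by move=> _ /imsetP[v + ->]; rewrite !inE !glueR => /eqP ->.
move=> f fl fA.
pose L i := [exists u, f (lshift m u) == i].
pose R i := [exists v, f (rshift n v) == i].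
pose P := [seq i <- iota 0 (l + k) | L i && ~~ R i].
pose M := [seq i <- iota 0 (l + k) | L i && R i].
pose Q := [seq i <- iota 0 (l + k) | ~~ L i].
have szPMQ : size P + size M + size Q = l + k.
  rewrite -[RHS](size_iota 0) !size_filter; elim: (iota 0 _) => //= i s.
  by case: (L i) (R i) => [] []; lia.
have Lf u : L (f (lshift m u)) by apply/existsP; exists u.
have Rf v : R (f (rshift n v)) by apply/existsP; exists v.
have inI i : f i \in iota 0 (l + k) by rewrite mem_iota fl.
have fPM u : (f \o lshift m) u \in P ++ M.
  by rewrite mem_cat !mem_filter inI !andbT Lf orNb.
have fQM v : (f \o @rshift n m) v \in Q ++ M.
  by rewrite mem_cat !mem_filter inI !andbT Rf andbT orNb.
have ML i : i \in M -> exists u, f (lshift m u) = i.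
  by rewrite mem_filter => /andP[/andP[/existsP[u /eqP] ? _] _]; exists u.
have MR i : i \in M -> exists v, f (rshift n v) = i.
  by rewrite mem_filter => /andP[/andP[_ /existsP[v /eqP] ?] _]; exists v.
have fAL := almost_properL fA; have fAR := almost_properR fA.
(* A colour in [M] marks exactly one vertex on each side, so on either side [M] can be merged in
   pairs. *)
have pairL : size P + uphalf (size M) <= l -> M = [::].
  move=> le_l; case EM: M => [//|i s].
  have /ML[u fu] : i \in M by rewrite EM inE eqxx.
  have: f (lshift m u) \notin M; last by rewrite EM fu inE eqxx.
  apply: (rigid_pairing gc fAL fPM _ _ le_l).
    by move=> j; rewrite !mem_filter => /andP[/andP[-> ->]].
  move=> x y /MR[v fv] fxy; exact: almost_proper_mixedL (esym fv) fxy.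
have pairR : size Q + uphalf (size M) <= k -> M = [::].
  move=> le_k; case EM: M => [//|i s].
  have /MR[v fv] : i \in M by rewrite EM inE eqxx.
  have: f (rshift n v) \notin M; last by rewrite EM fv inE eqxx.
  apply: (rigid_pairing hd fAR fQM _ _ le_k).
    by move=> j; rewrite !mem_filter => /andP[/andP[-> _]].
  move=> x y /ML[u fu] fxy; exact: almost_proper_mixedR (esym fu) fxy.
(* Failure of both bounds would give [size P + size Q + 2 * uphalf (size M) >= l + k + 2], but
   [2 * uphalf (size M)] is at most [size M + 1]. *)
have M0 : M = [::].
  have [/pairL //|ltP] := leqP (size P + uphalf (size M)) l.
  apply: pairR; have := uphalfK (size M); case: (odd _); lia.
have fP u : (f \o lshift m) u \in P by have := fPM u; rewrite M0 cats0.
have fQ v : (f \o @rshift n m) v \in Q by have := fQM v; rewrite M0 cats0.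
(* The two lower bounds add up to the number of available colours, so both are attained. *)
have lP := rigid_colours gc l0 fAL fP.
have kQ := rigid_colours hd k0 fAR fQ.
have eP : size P = l by move: szPMQ; rewrite M0 /=; lia.
have eQ : size Q = k by move: szPMQ; rewrite M0 /=; lia.
(* Positions in [P] renumber the left colours below [l], so that uniqueness applies. *)
have kerL u u' : (f (lshift m u) == f (lshift m u')) = (c u == c u').
  have F w : index ((f \o lshift m) w) P < l.
    by rewrite -eP index_mem.
  rewrite -(rigid_unique gc F).
    by apply/eqP/eqP => [/= -> //|]; apply: (index_inj 0).
  move=> x y x' y' xy xy' e1 e2 e3.
  apply: fAL xy xy' _ _ _; exact: (index_inj 0 (fP _) (fP _)).
have kerR v v' : (f (rshift n v) == f (rshift n v')) = (d v == d v').
  have F w : index ((f \o @rshift n m) w) Q < k.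
    by rewrite -eQ index_mem.
  rewrite -(rigid_unique hd F).
    by apply/eqP/eqP => [/= -> //|]; apply: (index_inj 0).
  move=> x y x' y' xy xy' e1 e2 e3.
  apply: fAR xy xy' _ _ _; exact: (index_inj 0 (fQ _) (fQ _)).
have neLR u v : f (lshift m u) != f (rshift n v).
  apply/eqP => e; have := fQ v; rewrite mem_filter /= -e.
  by rewrite Lf.
have neC u v : c u != l + d v by have := rigid_lt gc u; lia.
apply: ord_sumW => u; apply: ord_sumW => v; rewrite ?glueL ?glueR.
- exact: kerL.
- by rewrite (negPf (neLR _ _)) (negPf (neC _ _)).
- by rewrite eq_sym (negPf (neLR _ _)) eq_sym (negPf (neC _ _)).
- by rewrite eqn_add2l kerR.
Qed.

End Glue.

(** * Witnesses for (ARS1)-(ARS3) in the complement, and their behaviour under joins *)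

Definition compl_rel (T : finType) (g : rel T) : rel T := fun u v => (u != v) && ~~ g u v.

(** As in (ARS1) for the complement: colours below [s] are its stable sets, the other [t] its
    cliques. *)
Definition split_into (T : finType) (g : rel T) (s t : nat) : Prop :=
  exists p : T -> nat, (forall u, p u < s + t) /\
    forall u v, u != v -> p u = p v -> g u v = (p u < s).

(** [J] is the exceptional graph as seen in the complement, hence the negation. *)
Definition special_at (T : Type) (g : rel T) (b : bool) (k : nat) (J : rel nat) (p : T -> nat)
    (u v : T) : bool :=
  [&& (p u == p v) ==> (k <= p u) && ~~ g u v,
      (p u < k) && (p v == k) ==> (g u v == b) &
      (p u < k) && (p v < k) ==> (g u v == ~~ J (p u) (p v))].

Lemma special_at_same (T : Type) (g : rel T) b k J p u v :
  special_at g b k J p u v -> p u = p v -> k <= p u /\ ~~ g u v.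
Proof. by case/and3P => /implyP H _ _ E; apply/andP/H/eqP. Qed.

(* Colours below [k] name the vertices of the exceptional graph, colour [k] is the stable set
   completely joined ([b]) or completely non-adjacent ([~~ b]) to it, and the other [l - 1] colours
   are stable sets. *)
Definition special (T : finType) (g : rel T) (l : nat) (b : bool) (k : nat) (J : rel nat) : Prop :=
  exists p : T -> nat, (forall u, p u < k + l) /\
    forall u v, u != v -> special_at g b k J p u v.

(** The edges [a b] and [x y] span a $K_4$; in the complement they are the two non-edges of
    (ARS3). *)
Definition matched (T : finType) (g : rel T) (c : T -> nat) : Prop :=
  exists a b x y : T, [/\ c a = c b, c x = c y, c a != c x,
    [&& g a b, g x y, g a x, g a y, g b x & g b y] &
    forall u v, g u v -> c u = c v -> (u, v) \in [:: (a, b); (b, a); (x, y); (y, x)]].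

Section Join.
Variables (n m : nat) (g : rel 'I_n) (h : rel 'I_m).

(** Cliques of the two sides unite to cliques of the join, so clique colours are shared; stable sets
    cannot cross the join, so [t] and [t'] add. *)
Lemma split_into_join s t t' : split_into g s t -> split_into h s t' ->
  split_into (join g h) s (t + t').
Proof.
case=> p [pl pg] [q [ql qh]].
exists (glue p (fun v => if q v < s then q v else q v + t)); split.
  apply: ord_sumW => u; rewrite ?glueL ?glueR; first by have := pl u; lia.
  by have := ql u; case: ifP; lia.
apply: ord_sumW => u; apply: ord_sumW => v; rewrite !joinE ?glueL ?glueR ?eq_lshift ?eq_rshift.
- exact: pg.
- move=> _; have := pl u; case: ifP; lia.
- move=> _; have := pl v; case: ifP; lia.
- move=> uv e; have e' : q u = q v by move: e; case: ifP; case: ifP; lia.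
  by rewrite (qh _ _ uv e'); case: ifP => [->//|]; lia.
Qed.

(** The classes of the proper colouring [d] stay stable in the join and are appended as ordinary
    colours. *)
Lemma special_join l k b r J d : 0 < l -> rigid h k d ->
  (forall u v, h u v -> d u != d v) -> special g l b r J ->
  special (join g h) (l + k) b r J.
Proof.
move=> l0 hd dh [p [pl pg]].
exists (glue p (fun v => r + l + d v)); split.
  apply: ord_sumW => u; rewrite ?glueL ?glueR; first by have := pl u; lia.
  by have := rigid_lt hd u; lia.
apply: ord_sumW => u; apply: ord_sumW => v; rewrite ?eq_lshift ?eq_rshift => uv;
  rewrite /special_at !joinE ?glueL ?glueR.
- exact: pg.
- by have := pl u; move=> ?; apply/and3P; split; lia.
- by have := pl v; move=> ?; apply/and3P; split; lia.
- apply/and3P; split; try lia.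
  apply/implyP => /eqP e; apply/andP; split; first lia.
  by apply/negP => /dh; apply/negP; rewrite negbK; apply/eqP; lia.
Qed.

Lemma matched_join l c d : (forall u, c u < l) -> 
  (forall u v, h u v -> d u != d v) -> matched g c ->
  matched (join g h) (glue c (fun v => l + d v)).
Proof.
move=> cl dh [a [b [x [y [ab xy ax K G]]]]].
exists (lshift m a), (lshift m b), (lshift m x), (lshift m y).
rewrite !glueL !joinE; split=> //.
apply: ord_sumW => u; apply: ord_sumW => v; rewrite !joinE ?glueL ?glueR.
- by move=> uv e; have := G _ _ uv e; rewrite !inE !xpair_eqE !eq_lshift.
- by move=> _; have := cl u; lia.
- by move=> _; have := cl v; lia.
- by move=> /dh; lia.
Qed.

End Join.

(** * Translation to the complement *)

Section Conversion.
Variables (T : finType) (g : rel T) (l : nat).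
Let e := compl_rel g.

Lemma cliques_plus_special (P : {set T} -> Prop) b k J : 1 < l ->
  (forall p : T -> nat, (forall u v, u != v -> special_at g b k J p u v) ->
     P ([set u | p u < k] :|: [set u | p u == k])) ->
  special g l b k J -> cliques_plus e l P.
Proof.
move=> l2 HP [p [pl pg]].
have [l' el] : exists l', l = l'.+2 by exists l.-2; lia.
subst l.
(* The [l - 1] colours above [k] shift down to start at 0; smaller colours truncate to 0,
   harmlessly, since their vertices lie in the exceptional set. *)
exists ([set u | p u < k] :|: [set u | p u == k]), (fun u => inord (p u - k.+1)); split.
  exact: HP.
move=> u v; rewrite !inE => uS vS uv /(congr1 val); rewrite /= !inordK; 
  try by [have := pl u; lia | have := pl v; lia].
move=> euv; rewrite /e /compl_rel uv /=.
have [] // := special_at_same (pg _ _ uv) _; lia.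
Qed.

(** Distinct vertices never share a colour below [k.+1], so the colours themselves embed into
    [J]. *)
Lemma special_iota k (J : rel 'I_k.+1) (J' : rel nat) b p :
  (forall i j : 'I_k.+1, J i j = J' i j) -> (forall i, ~~ J' i i) ->
  (forall u v, u != v -> special_at g b k.+1 J' p u v) ->
  [/\ [set u | p u < k.+1] :&: [set u | p u == k.+1] = set0,
     induces_iota e J [set u | p u < k.+1], clique e [set u | p u == k.+1] &
     {in [set u | p u < k.+1] & [set u | p u == k.+1], forall u v, e u v = ~~ b}].
Proof.
move=> JJ J0 pg; split.
- by apply/setP=> u; rewrite !inE; lia.
- exists (fun u => inord (p u)); split=> u v; rewrite !inE => uk vk.
    move/(congr1 val); rewrite /= !inordK // => euv.
    apply/eqP; apply: contraT => uv.
    by have [] := special_at_same (pg _ _ uv) euv; lia.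
  rewrite JJ !inordK // /e /compl_rel; case: (altP (u =P v)) => [->|uv] /=.
    by rewrite (negPf (J0 _)).
  by have /and3P[_ _] := pg _ _ uv; rewrite uk vk /= => /eqP ->; rewrite negbK.
- apply/forall_inP=> u; rewrite inE => /eqP uk; apply/forall_inP=> v; rewrite inE => /eqP vk.
  apply/implyP=> uv; rewrite /e /compl_rel uv /=.
  by have [] // := special_at_same (pg _ _ uv) _; rewrite uk vk.
- move=> u v; rewrite !inE => uk /eqP vk.
  have uv : u != v by apply/eqP=> E; move: uk; rewrite E vk ltnn.
  have /and3P[_ + _] := pg _ _ uv.
  by rewrite uk vk eqxx /= /e /compl_rel uv => /eqP ->.
Qed.

(** Complementation reverses the flag: [true], full adjacency in [g], gives a disjoint union. *)
Lemma special_or k (J : rel 'I_k.+1) (J' : rel nat) :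
  (forall i j : 'I_k.+1, J i j = J' i j) -> (forall i, ~~ J' i i) ->
  1 < l -> special g l true k.+1 J' -> cliques_plus e l (in_iota_or_C e J).
Proof.
move=> JJ J0 l2; apply: cliques_plus_special => // p /(special_iota JJ J0)[H1 H2 H3 H4].
exists [set u | p u < k.+1], [set u | p u == k.+1]; by split=> // u v uk vk; rewrite (H4 _ _ uk vk).
Qed.

Lemma special_and k (J : rel 'I_k.+1) (J' : rel nat) :
  (forall i j : 'I_k.+1, J i j = J' i j) -> (forall i, ~~ J' i i) ->
  1 < l -> special g l false k.+1 J' -> cliques_plus e l (in_iota_and_C e J).
Proof.
move=> JJ J0 l2; apply: cliques_plus_special => // p /(special_iota JJ J0)[H1 H2 H3 H4].
exists [set u | p u < k.+1], [set u | p u == k.+1]; by split.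
Qed.

(** Additional classes stay empty; stable colours are shifted past the new clique colours. *)
Lemma split_into_weaken s t s' t' : 0 < s -> s <= s' -> t <= t' ->
  split_into g s t -> split_into g s' t'.
Proof.
move=> s0 ss tt [p [pl pg]].
exists (fun u => if p u < s then p u else p u + (s' - s)); split.
  by move=> u; have := pl u; case: ifP; lia.
move=> u v uv E; have E' : p u = p v by move: E; case: ifP; case: ifP; lia.
by rewrite (pg _ _ uv E'); case: ltnP => ?; apply/esym; lia.
Qed.

Lemma ARS1_split_into :
  (forall s, 1 <= s <= l -> split_into g s (l - s)) -> ARS1 e l.
Proof.
move=> H s sl; have [p [pl pg]] := H s sl.
have pl' u : p u < l by have := pl u; lia.
exists (fun u => Ordinal (pl' u)) => u v uv /(congr1 val) /= E.
by rewrite /e /compl_rel uv (pg _ _ uv E); case: (p u < s).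
Qed.

Variable c : T -> nat.
Hypothesis gc : rigid g l c.

Lemma nonedgesP (Y : {set T}) u v : u \in Y -> v \in Y -> g u v ->
  [set u; v] \in nonedges e Y.
Proof.
move=> uY vY uv.
have nuv : u != v by apply: contraTN uv => /eqP ->; rewrite (rigid_irr gc).
rewrite inE cards2 nuv /=; apply/andP; split.
  by apply/subsetP=> w; rewrite !inE => /orP[]/eqP ->.
apply/forall_inP=> x; rewrite !inE => xE; apply/forall_inP=> y; rewrite !inE => yE.
apply/implyP=> xy; rewrite /e /compl_rel xy negbK.
by case/orP: xE xy => /eqP ->; case/orP: yE => /eqP ->; rewrite ?eqxx // (rigid_sym gc).
Qed.

Lemma nonedgesE (Y E : {set T}) : E \in nonedges e Y ->
  exists u v, [/\ u \in Y, v \in Y, g u v & E = [set u; v]].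
Proof.
rewrite inE => /and3P[/cards2P[u [v [uv ->]]] /subsetP sub /forall_inP H].
exists u, v; split; rewrite ?sub ?inE ?eqxx ?orbT //.
have /forall_inP/(_ v) := H u (set21 u v).
by rewrite set22 uv /e /compl_rel uv negbK; apply.
Qed.

Lemma ARS34_matched : matched g c -> ARS34 e l.
Proof.
move=> [a [b [x [y [ab xy ax /and5P[gab gxy gax gay /andP[gbx gby]] G]]]]].
pose X0 := preim_partition c [set: T].
pose cls i := [set u | c u == i].
have X0E : X0 = [set cls (c u) | u in [set: T]].
  apply: eq_imset => u; apply/setP=> v; rewrite !inE; exact: eq_sym.
have clsX u : cls (c u) \in X0 by rewrite X0E imset_f.
exists X0; split.
- exact: preim_partitionP.
- have -> : X0 = [set cls i | i : 'I_l in [set: 'I_l]].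
    rewrite X0E; apply/setP=> Y; apply/imsetP/imsetP => -[u _ ->].
      by exists (Ordinal (rigid_lt gc u)).
    by have [v cv] := rigid_onto gc (ltn_ord u); exists v => //; rewrite cv.
  rewrite card_imset ?cardsT ?card_ord // => i j /setP E; apply: val_inj.
  have [v cv] := rigid_onto gc (ltn_ord i).
  by have := E v; rewrite !inE cv eqxx => /esym/eqP.
- exists (cls (c a)), (cls (c x)).
  have neA : cls (c a) != cls (c x).
    by apply/eqP => /setP/(_ a); rewrite !inE eqxx (negPf ax).
  have nA : nonedges e (cls (c a)) = [set [set a; b]].
    apply/setP=> E; rewrite in_set1; apply/idP/eqP => [/nonedgesE|->].
      move=> [u [v [+ + uv ->]]]; rewrite !inE => /eqP cu /eqP cv.
      have := G _ _ uv (etrans cu (esym cv)); rewrite !inE !xpair_eqE.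
      case/or4P => /andP[/eqP eu /eqP ev]; rewrite ?eu ?ev //.
      + by rewrite setUC.
      + by rewrite -cu eu eqxx in ax.
      + by rewrite -cu eu xy eqxx in ax.
    by apply: nonedgesP => //; rewrite inE ?ab.
  have nB : nonedges e (cls (c x)) = [set [set x; y]].
    apply/setP=> E; rewrite in_set1; apply/idP/eqP => [/nonedgesE|->].
      move=> [u [v [+ + uv ->]]]; rewrite !inE => /eqP cu /eqP cv.
      have := G _ _ uv (etrans cu (esym cv)); rewrite !inE !xpair_eqE.
      case/or4P => /andP[/eqP eu /eqP ev]; rewrite ?eu ?ev //.
      + by rewrite -cu eu eqxx in ax.
      + by rewrite -cu eu ab eqxx in ax.
      + by rewrite setUC.
    by apply: nonedgesP => //; rewrite inE ?xy.
  split; first by split.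
  rewrite nA nB !cards1; split=> //.
    move=> X; rewrite X0E => /imsetP[w _ ->] nwa nwx.
    have cwa : c w != c a by apply: contraNneq nwa => ->.
    have cwx : c w != c x by apply: contraNneq nwx => ->.
    apply/forall_inP=> u; rewrite inE => /eqP cu; apply/forall_inP=> v; rewrite inE => /eqP cv.
    apply/implyP=> uv; rewrite /e /compl_rel uv /=; apply/negP=> guv.
    have := G _ _ guv (etrans cu (esym cv)); rewrite !inE !xpair_eqE.
    case/or4P => /andP[/eqP eu /eqP ev]; move: cwa cwx;
      by rewrite -cu eu ?ab ?xy ?eqxx.
  rewrite bigcup_setU !big_set1.
  have gs u v : g u v = g v u by exact: rigid_sym gc u v.
  apply/forall_inP=> u; rewrite !inE => Hu; apply/forall_inP=> v; rewrite !inE => Hv.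
  rewrite /e /compl_rel negb_and negbK negbK.
  by case/orP: Hu => /orP[]/eqP ->; case/orP: Hv => /orP[]/eqP ->;
     rewrite ?eqxx // ?gab ?gxy ?gax ?gay ?gbx ?gby ?orbT // gs
       ?gab ?gxy ?gax ?gay ?gbx ?gby ?orbT.
move=> X XP Xl.
have [/exists_inP[Y YX Y2] _|noY] := boolP [exists Y in X, 2 <= #|nonedges e Y|].
  by exists Y.
case/negP.
have covX u : u \in cover X by rewrite (cover_partition XP) inE.
have trX : trivIset X by case/and3P: XP.
(* Numbering the blocks turns a partition violating (ARS4) into an admissible colouring. *)
pose f u := index (pblock X u) (enum X).
have bX u : pblock X u \in enum X by rewrite mem_enum pblock_mem.
have fl u : f u < l by rewrite -Xl cardE index_mem.
have fK u v : f u = f v -> pblock X u = pblock X v by exact: (index_inj set0).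
have fA : almost_proper g f.
  move=> u v u' v' uv uv' /fK E1 /fK E2 /fK E3.
  set Y := pblock X u.
  have inY w : pblock X w = Y -> w \in Y by move=> <-; rewrite mem_pblock.
  have YX : Y \in X by rewrite pblock_mem.
  have Y1 : #|nonedges e Y| <= 1.
    by rewrite leqNgt; apply: contra noY => Y2; apply/exists_inP; exists Y.
  have uvY : [set u; v] \in nonedges e Y.
    by apply: nonedgesP uv; apply: inY; rewrite -?E1.
  have uvY' : [set u'; v'] \in nonedges e Y.
    by apply: nonedgesP uv'; apply: inY; rewrite -?E2 -?E3.
  by rewrite (card_le1_eqP Y1 _ _ uvY uvY').
(* Both partitions are recovered from their kernels, which uniqueness identifies. *)
apply/eqP; rewrite -(preim_partition_pblock XP).
apply: eq_imset => u; apply/setP=> v; rewrite !inE /=.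
rewrite -(rigid_unique gc fl fA); apply/eqP/eqP => [E|/fK //].
by rewrite /f E.
Qed.

End Conversion.

(** * Decision procedures and the two explicit graphs *)

Definition edge_rel (E : seq (nat * nat)) : rel nat :=
  fun u v => ((u, v) \in E) || ((v, u) \in E).

Definition edge_graph (n : nat) (E : seq (nat * nat)) : rel 'I_n :=
  fun u v => edge_rel E u v.

(** Edges will be listed once, larger end second, so [e.2 < size s] says that the prefix [s] colours
    both ends, and [uniq] of this list allows each colour one monochromatic edge. *)
Definition mono_colours (E : seq (nat * nat)) (s : seq nat) : seq nat :=
  [seq nth 0 s e.1 | e <- E & (e.2 < size s) && (nth 0 s e.1 == nth 0 s e.2)].

Definition same_kernel (s t : seq nat) : bool :=
  all (fun i => all (fun j => (nth 0 s i == nth 0 s j) == (nth 0 t i == nth 0 t j))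
    (iota 0 (size t))) (iota 0 (size t)).

(* The conditional prunes the call-by-value evaluation, which a boolean disjunction would not. *)
Fixpoint all_extensions (E : seq (nat * nat)) (l : nat) (c : seq nat) (k : nat) (s : seq nat) : bool :=
  if uniq (mono_colours E s) then
    if k is k'.+1 then all (fun i => all_extensions E l c k' (rcons s i)) (iota 0 l)
    else same_kernel s c
  else true.

Definition rigid_check (n : nat) (E : seq (nat * nat)) (l : nat) (c : seq nat) : bool :=
  [&& size c == n, uniq E, all (fun e => e.1 < e.2 < n) E,
      all (fun i => i < l) c, all (fun i => 2 < count_mem i c) (iota 0 l) &
      all_extensions E l c n [::]].

Lemma all_ordW n (P : pred nat) : all P (iota 0 n) -> forall u : 'I_n, P u.
Proof. by move/allP=> H u; apply: H; rewrite mem_iota add0n ltn_ord. Qed.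

Lemma all_ord2W n (P : rel nat) :
  all (fun u => all (P u) (iota 0 n)) (iota 0 n) -> forall u v : 'I_n, P u v.
Proof. by move/all_ordW=> H u v; exact: (all_ordW (H u) v). Qed.

Lemma rigid_checkP n E l c : rigid_check n E l c ->
  rigid (@edge_graph n E) l (fun u => nth 0 c u).
Proof.
case/and5P=> /eqP szc uE /allP En /allP cl /andP[/allP cbig ext].
have cn (u : 'I_n) : nth 0 c u \in c by rewrite mem_nth ?szc.
have mapc : [seq nth 0 c (val u) | u <- enum 'I_n] = c.
  by rewrite (map_comp (nth 0 c) val) val_enum_ord -szc -/(mkseq _ _) mkseq_nth.
have cardc i : #|[set v : 'I_n | nth 0 c v == i]| = count_mem i c.
  rewrite -{2}mapc count_map cardsE cardE size_filter.
  by rewrite enumT; apply: eq_count => v; rewrite inE.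
split.
- move=> u; apply/negP => /orP[] /En; rewrite ltnn //.
- by move=> u v; rewrite /edge_graph /edge_rel orbC.
- by move=> u; apply: cl.
- move=> i il; have : 0 < count_mem i c.
    by apply: (ltn_trans _ (cbig i _)); rewrite ?mem_iota.
  by rewrite -cardc => /card_gt0P[u]; rewrite inE => /eqP; exists u.
- by move=> u; rewrite cardc; apply: cbig; rewrite mem_iota cl.
move=> f fl fA.
pose s := [seq f u | u <- enum 'I_n].
have szs : size s = n by rewrite size_map size_enum_ord.
have ns (u : 'I_n) : nth 0 s u = f u by rewrite (nth_map u) ?size_enum_ord ?nth_ord_enum.
have okp k : uniq (mono_colours E (take k s)).
  rewrite map_inj_in_uniq ?filter_uniq //.
  have ltk i : i < size (take k s) -> i < k.
    by rewrite size_take_min leq_min => /andP[].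
  case=> u v [u' v']; rewrite !mem_filter /= => /andP[/andP[vk +] uvE] /andP[/andP[vk' +] uvE'].
  have /andP[uv vn] := En _ uvE; have /andP[uv' vn'] := En _ uvE'; simpl in *.
  have un := ltn_trans uv vn; have un' := ltn_trans uv' vn'.
  rewrite !nth_take ?ltk // ?(ltn_trans uv) ?(ltn_trans uv') //.
  rewrite -[u]/(val (Ordinal un)) -[v]/(val (Ordinal vn)) -[u']/(val (Ordinal un'))
    -[v']/(val (Ordinal vn')) !ns => /eqP e1 /eqP e2 e3.
  have := fA (Ordinal un) (Ordinal vn) (Ordinal un') (Ordinal vn').
  rewrite /edge_graph /edge_rel uvE uvE' => /(_ isT isT e1 e2 e3) /setP S.
  have := S (Ordinal un); have := S (Ordinal vn).
  have := S (Ordinal un'); have := S (Ordinal vn').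
  rewrite !inE -!val_eqE /= => *; suff : u = u' /\ v = v' by case=> -> ->.
  by lia.
(* Every prefix of an admissible colouring passes the [uniq] test, so the search is never cut off
   along [s] and reaches the kernel comparison. *)
have extk k : k <= n -> all_extensions E l c (n - k) (take k s).
  elim: k => [_|k IH kn]; first by rewrite subn0 take0.
  have := IH (ltnW kn); rewrite -(subnSK kn) /= okp => /allP/(_ (nth 0 s k)).
  rewrite -take_nth ?szs //; apply.
  by rewrite mem_iota /= -[k]/(val (Ordinal kn)) ns.
have := extk n (leqnn n); rewrite subnn /= okp take_oversize ?szs // /same_kernel szc.
by move=> /all_ord2W K u v; have /eqP := K u v; rewrite !ns.
Qed.

Definition special_check (n : nat) (g : rel nat) l b k J (p : seq nat) : bool :=
  all (fun u => nth 0 p u < k + l) (iota 0 n) &&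
  all (fun u => all (fun v => (u != v) ==> special_at g b k J (nth 0 p) u v) (iota 0 n)) (iota 0 n).

Lemma special_checkP n E l b k J p : special_check n (edge_rel E) l b k J p ->
  special (@edge_graph n E) l b k J.
Proof.
case/andP=> /all_ordW pl /all_ord2W pg; exists (fun u : 'I_n => nth 0 p u); split=> // u v uv.
exact: (implyP (pg u v) uv).
Qed.

Definition split_check (n : nat) (g : rel nat) s t (p : seq nat) : bool :=
  all (fun u => nth 0 p u < s + t) (iota 0 n) &&
  all (fun u => all (fun v => (u != v) && (nth 0 p u == nth 0 p v) ==>
     (g u v == (nth 0 p u < s))) (iota 0 n)) (iota 0 n).

Lemma split_checkP n E s t p : split_check n (edge_rel E) s t p ->
  split_into (@edge_graph n E) s t.
Proof.
case/andP=> /all_ordW pl /all_ord2W pg; exists (fun u : 'I_n => nth 0 p u); split=> // u v uv puv.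
by apply/eqP/(implyP (pg u v)); rewrite puv eqxx andbT.
Qed.

(** Singletons are cliques; this supplies the 13 cliques for [base] and for each gadget. *)
Lemma split_into_size n (g : rel 'I_n) s : n <= s -> split_into g s 0.
Proof.
move=> ns; exists val; split=> [u|u v /eqP uv /val_inj //].
by rewrite addn0 (leq_trans (ltn_ord u)).
Qed.

(* Both graphs were found by a computer search; the vertices are numbered so that the backtracking
   in [all_extensions] stays small. *)
Definition base_edges : seq (nat * nat) :=
  [:: (0, 1); (0, 2); (0, 4); (0, 5); (0, 6); (0, 9); (1, 2); (1, 3); (1, 4); (1, 8);
      (2, 3); (2, 5); (2, 6); (2, 7); (2, 8); (2, 10); (3, 4); (3, 5); (3, 9); (4, 5);
      (4, 6); (4, 7); (4, 8); (6, 7); (6, 11); (6, 12); (7, 8); (7, 9); (7, 10); (8, 9);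
      (8, 10); (8, 11); (8, 12); (9, 10); (9, 11); (9, 12); (10, 11); (10, 12)].
Definition base_colouring : seq nat := [:: 1; 0; 2; 1; 2; 0; 0; 1; 1; 0; 0; 2; 2].
Definition base : rel 'I_13 := @edge_graph 13 base_edges.

Definition gadget_edges : seq (nat * nat) :=
  [:: (0, 1); (0, 2); (0, 3); (0, 6); (0, 8); (0, 9); (0, 10); (0, 11); (1, 3); (1, 4);
      (1, 5); (1, 8); (1, 10); (2, 3); (2, 4); (2, 5); (2, 6); (2, 7); (2, 8); (2, 10);
      (3, 4); (3, 5); (3, 7); (3, 9); (3, 11); (4, 6); (5, 6); (6, 9); (6, 11); (7, 8);
      (7, 9); (7, 10); (7, 11)].
Definition gadget_colouring : seq nat := [:: 1; 0; 0; 2; 1; 1; 2; 1; 2; 0; 2; 0].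
Definition gadget : rel 'I_12 := @edge_graph 12 gadget_edges.

Lemma base_rigid : rigid base 3 (fun u => nth 0 base_colouring u).
Proof. by apply: rigid_checkP; vm_compute. Qed.

Lemma gadget_rigid : rigid gadget 3 (fun u => nth 0 gadget_colouring u).
Proof. by apply: rigid_checkP; vm_compute. Qed.

Lemma gadget_proper u v : gadget u v ->
  nth 0 gadget_colouring u != nth 0 gadget_colouring v.
Proof.
apply/implyP; move: u v; apply: (@all_ord2W _ (fun u v => edge_rel gadget_edges u v ==>
  (nth 0 gadget_colouring u != nth 0 gadget_colouring v))).
by vm_compute.
Qed.

Lemma gadget_split : split_into gadget 1 2.
Proof. by apply: (@split_checkP _ _ _ _ [:: 0; 1; 0; 0; 2; 2; 1; 1; 2; 2; 2; 2]); vm_compute. Qed.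

Lemma base_split : split_into base 1 3.
Proof. by apply: (@split_checkP _ _ _ _ [:: 2; 1; 3; 2; 3; 1; 1; 2; 0; 3; 1; 2; 2]); vm_compute. Qed.

Lemma base_matched : matched base (fun u => nth 0 base_colouring u).
Proof.
(* The only monochromatic edges are {9, 10} in colour 0 and {7, 8} in colour 1. *)
exists (@Ordinal 13 10 isT), (@Ordinal 13 9 isT), (@Ordinal 13 8 isT), (@Ordinal 13 7 isT).
split=> // u v uv /eqP; apply/implyP; move: u v uv => u v; apply/implyP.
rewrite !inE !xpair_eqE -!val_eqE /=; move: u v.
apply: (@all_ord2W _ (fun u v => edge_rel base_edges u v ==>
  (nth 0 base_colouring u == nth 0 base_colouring v) ==>
  [|| (u == 10) && (v == 9), (u == 9) && (v == 10),
      (u == 8) && (v == 7) | (u == 7) && (v == 8)])).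
by vm_compute.
Qed.

(** Counterparts on [nat] of the relations on ordinals, for computation on lists. *)
Definition C4_nat : rel nat := fun i j => ((i + 1) %% 4 == j) || ((j + 1) %% 4 == i).
Definition coP3_nat : rel nat := fun i j => (i == 0) && (j == 2) || (i == 2) && (j == 0).
Definition empty_nat : rel nat := fun _ _ => false.

Lemma base_special_K1 : special base 3 true 1 empty_nat.
Proof. by apply: (@special_checkP _ _ _ _ _ _ [:: 3; 2; 1; 3; 1; 2; 2; 3; 0; 1; 2; 3; 3]); vm_compute. Qed.

Lemma base_special_S3 : special base 3 false 3 empty_nat.
Proof. by apply: (@special_checkP _ _ _ _ _ _ [:: 3; 5; 4; 3; 4; 5; 5; 2; 1; 5; 0; 4; 4]); vm_compute. Qed.

Lemma base_special_C4 : special base 3 false 4 C4_nat.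
Proof. by apply: (@special_checkP _ _ _ _ _ _ [:: 2; 6; 5; 4; 5; 6; 0; 6; 3; 5; 1; 6; 6]); vm_compute. Qed.

Lemma base_special_coP3 : special base 3 false 3 coP3_nat.
Proof. by apply: (@special_checkP _ _ _ _ _ _ [:: 5; 0; 4; 5; 4; 3; 3; 5; 1; 4; 2; 5; 5]); vm_compute. Qed.

(** * Iterated joins with the gadget and the conclusion *)

Record tower (k n : nat) (g : rel 'I_n) (c : 'I_n -> nat) : Prop := Tower {
  tower_rigid : rigid g (3 + k * 3) c;
  tower_matched : matched g c;
  tower_K1 : special g (3 + k * 3) true 1 empty_nat;
  tower_S3 : special g (3 + k * 3) false 3 empty_nat;
  tower_C4 : special g (3 + k * 3) false 4 C4_nat;
  tower_coP3 : special g (3 + k * 3) false 3 coP3_nat;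
  tower_split1 : split_into g 1 (3 + k * 2);
  tower_split13 : split_into g 13 0 }.

Lemma tower_exists k : exists n (g : rel 'I_n) c, tower k g c.
Proof.
elim: k => [|k [n [g [c [R M S1 S2 S3 S4 s1 s13]]]]].
  exists 13, base, (fun u => nth 0 base_colouring u); split.
  - exact: base_rigid.
  - exact: base_matched.
  - exact: base_special_K1.
  - exact: base_special_S3.
  - exact: base_special_C4.
  - exact: base_special_coP3.
  - exact: base_split.
  - exact: split_into_size.
exists (n + 12), (join g gadget),
  (glue c (fun v : 'I_12 => 3 + k * 3 + nth 0 gadget_colouring v)).
have e3 : 3 + k.+1 * 3 = 3 + k * 3 + 3 by lia.
have e2 : 3 + k.+1 * 2 = 3 + k * 2 + 2 by lia.
split; rewrite ?e3 ?e2.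
- exact: rigid_join R gadget_rigid.
- exact: (matched_join (rigid_lt R) gadget_proper).
- exact: (special_join _ gadget_rigid gadget_proper).
- exact: (special_join _ gadget_rigid gadget_proper).
- exact: (special_join _ gadget_rigid gadget_proper).
- exact: (special_join _ gadget_rigid gadget_proper).
- exact: split_into_join gadget_split.
- by apply: (split_into_join s13); apply: split_into_size.
Qed.

Lemma tower_ARS k n (g : rel 'I_n) c : 13 <= k -> tower k g c ->
  ARS_graph (compl_rel g) (3 + k * 3).
Proof.
move=> k13 [R M S1 S2 S3 S4 s1 s13]; have l2 : 1 < 3 + k * 3 by lia.
split=> //.
(* For [s <= k] the remaining [3 + k * 3 - s] stable sets of [g] are at least [3 + k * 2]; for
   [s > k] there are more than 13 cliques. *)
- apply: ARS1_split_into => s sl; have [sk|ks] := leqP s k.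
    by apply: (split_into_weaken _ _ _ s1); lia.
  by apply: (split_into_weaken _ _ _ s13); lia.
- split.
  + by apply: (special_or _ _ l2 S1).
  + by apply: (special_and _ _ l2 S2).
  + by apply: (special_and _ _ l2 S3) => // i; rewrite /C4_nat; lia.
  + by apply: (special_and _ _ l2 S4) => // i; rewrite /coP3_nat; lia.
- exact: ARS34_matched R M.
Qed.

Theorem theorem3p1 :
  forall N : nat, exists l : nat, N < l /\
    exists (n : nat) (e : rel 'I_n), simple_graph e /\ ARS_graph e l.
Proof.
move=> N; have [n [g [c t]]] := tower_exists (N + 13).
exists (3 + (N + 13) * 3); split; first by lia.
exists n, (compl_rel g); split; last by apply: tower_ARS t; lia.
split=> [u|u v]; first by rewrite /compl_rel eqxx.
by rewrite /compl_rel eq_sym (rigid_sym (tower_rigid t)).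
Qed.
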